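(* There exists a cubic graph $G$ with $bed(G)=urd(3\frac12,\frac12)$.
   Context: Graphs are finite and undirected; parallel edges are allowed, loops are not. A cubic graph is a graph in which every vertex has degree $3$. For real numbers $r\ge 2$ and $\alpha\ge 0$, an $(r,\alpha)$-flow in a directed graph $D=(V,E)$ is an assignment $f:E\to[1,r-1]$ such that for every vertex $x\in V$, $\left|\sum_{e\in E^+(x)}f(e)-\sum_{e\in E^-(x)}f(e)\right|\le\alpha$, where $E^+(x)$, respectively $E^-(x)$, is the set of edges directed from, respectively toward, $x$ in $D$. An undirected graph $G$ admits an $(r,\alpha)$-flow if some orientation of $G$ admits such a flow. For a cubic graph $G$, $bed(G)$ is the set of all pairs $(r,\alpha)$ (with $r\ge2$, $\alpha\ge0$) such that $G$ admits an $(r,\alpha)$-flow. For a point $(r_0,\alpha_0)$, the upper right domain $urd(r_0,\alpha_0)$ is the upper-right closed unbounded polygonal domain of the $r$-$\alpha$ plane whose vertices are $(2,\infty),(2,1),(r_0,\alpha_0),(\infty,\alpha_0)$. Explicitly, $urd(3\frac12,\frac12)=\{(r,\alpha): r\ge 2,\ \alpha\ge\frac12,\ \alpha\ge\frac{5-r}{3}\}$. Here $3\frac12=\frac72$. *)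

(* Defs.v *)
From mathcomp Require Import all_boot all_order all_algebra.
From mathcomp Require Import classical_sets reals.
From mathcomp Require Import lra.

Set Implicit Arguments.
Unset Strict Implicit.
Unset Printing Implicit Defensive.

Import Order.TTheory GRing.Theory Num.Theory.
Local Open Scope ring_scope.

(* Distinct edges may have the same set of ends (parallel edges), and the
   cardinality condition excludes loops. *)
Record multigraph (V E : finType) := Multigraph {
  ends : E -> {set V};
  card_ends : forall e, #|ends e| = 2%N }.

Definition degree (V E : finType) (G : multigraph V E) (x : V) : nat :=
  #|[set e | x \in ends G e]|.

Definition cubic (V E : finType) (G : multigraph V E) : Prop :=
  forall x : V, degree G x = 3%N.

Record digraph (V E : finType) := Digraph { tail : E -> V; head : E -> V }.

Definition orientation_of (V E : finType) (G : multigraph V E)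
    (D : digraph V E) : Prop :=
  forall e, ends G e = [set tail D e; head D e]%SET.

Definition is_flow (R : realType) (V E : finType) (D : digraph V E)
    (r alpha : R) (f : E -> R) : Prop :=
  (forall e, 1 <= f e <= r - 1) /\
  (forall x, `|\sum_(e | tail D e == x) f e - \sum_(e | head D e == x) f e|
               <= alpha).

Definition admits_flow (R : realType) (V E : finType) (G : multigraph V E)
    (r alpha : R) : Prop :=
  exists D : digraph V E, orientation_of G D /\
    exists f : E -> R, is_flow D r alpha f.

Definition bed (R : realType) (V E : finType) (G : multigraph V E) :
    set (R * R) :=
  [set p | 2 <= p.1 /\ 0 <= p.2 /\ admits_flow G p.1 p.2]%classic.

Arguments bed R {V E} G.

(* The closed domain with vertices (2, oo), (2, 1), (r0, a0), (oo, a0), where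
   2 <= r0 and a0 <= 1.  The last inequality says that (r, alpha) lies on or
   above the line through (2, 1) and (r0, a0); it is cleared of denominators,
   so that it is vacuous when r0 = 2. *)
Definition urd (R : realType) (r0 a0 : R) : set (R * R) :=
  [set p | [/\ 2 <= p.1, a0 <= p.2
             & (a0 - 1) * (p.1 - 2) <= (r0 - 2) * (p.2 - 1)]]%classic.

Lemma urd_7half_half (R : realType) :
  urd (7 / 2) (1 / 2) =
    [set p : R * R | [/\ 2 <= p.1, 1 / 2 <= p.2 & (5 - p.1) / 3 <= p.2]]%classic.
Proof.
by rewrite /urd; apply/seteqP; split=> -[r a] /= [h1 h2 h3]; split=> //; lra.
Qed.

(* Main.v *)
Require Import Defs.
From HB Require Import structures.
From mathcomp Require Import all_boot all_order all_algebra.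
From mathcomp Require Import classical_sets reals.
From mathcomp Require Import lra.

Set Implicit Arguments.
Unset Strict Implicit.
Unset Printing Implicit Defensive.

Import Order.TTheory GRing.Theory Num.Theory.
Local Open Scope ring_scope.

(** The graph consists of a centre joined by three bridges to three copies of a
    gadget: the vertices a, b, c with edges ab, ac and two edges bc, the bridge
    ending at a.

    Flows are handled as signed flows for one reference orientation: each edge
    carries a real number of absolute value in [1, r - 1], whose sign records
    the chosen direction ([admits_flow_signed]).

    Lower bound. Let [alpha < 1]. At the centre two of the bridges carry
    values of the same sign, so the third must have the opposite sign and carry
    at least [2 - alpha] in absolute value ([heavy_bridge]). All of this
    has to be absorbed by the three vertices of the gadget behind it, whence
    [2 - alpha <= 3 * alpha], that is [alpha >= 1/2] ([gadget_absorbs]).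
    Moreover the two edges bc force some edge of that gadget to carry at least
    [4 - 3 * alpha] ([gadget_capacity]), whence [r - 1 >= 4 - 3 * alpha], which
    is the slanted side of the domain.

    Upper bound. There is a flow with values in [1, 5/2] and imbalance at most
    1/2 at every vertex. Its orientation has no source and no sink, so the
    constant function 1 has imbalance 1 at every vertex for the same
    orientation. The convex combinations of these two flows realise the whole
    segment between (2, 1) and (7/2, 1/2), and the domain is the set of points
    above and to the right of some point of it. *)

(** * Signed flows *)

Definition net (R : realType) (V E : finType) (D : digraph V E) (f : E -> R)
    (x : V) : R :=
  \sum_(e | tail D e == x) f e - \sum_(e | Defs.head D e == x) f e.

Definition signed_flow (R : realType) (V E : finType) (D : digraph V E)
    (r alpha : R) (g : E -> R) : Prop :=
  (forall e, 1 <= `|g e| <= r - 1) /\ (forall x, `|net D g x| <= alpha).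

Lemma netE (R : realType) (V E : finType) (D : digraph V E) (f : E -> R) x :
  net D f x = \sum_e (f e *+ (tail D e == x) - f e *+ (Defs.head D e == x)).
Proof.
rewrite /net big_mkcond [X in _ - X]big_mkcond -sumrB /=.
by apply: eq_bigr => e _; do 2 case: eqP.
Qed.

Lemma orientation_of_cases (V E : finType) (G : multigraph V E)
    (D D' : digraph V E) (e : E) :
  orientation_of G D -> orientation_of G D' ->
  (tail D' e = tail D e /\ Defs.head D' e = Defs.head D e) \/
  [/\ tail D' e = Defs.head D e, Defs.head D' e = tail D e
    & tail D' e != tail D e].
Proof.
move=> oD oD'; have := card_ends G e.
have: [set tail D e; Defs.head D e]%SET =
      [set tail D' e; Defs.head D' e]%SET.
  by rewrite -oD -oD'.
rewrite oD cards2; case: eqP => // /eqP neq eqD _.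
have := set21 (tail D' e) (Defs.head D' e); rewrite -eqD !inE.
have := set22 (tail D' e) (Defs.head D' e); rewrite -eqD !inE.
have := set21 (tail D e) (Defs.head D e); rewrite eqD !inE.
have := set22 (tail D e) (Defs.head D e); rewrite eqD !inE.
do 4 case/orP=> /eqP ?; first [by left; split; congruence
  | by right; split; try congruence; apply/eqP => ?; case/eqP: neq; congruence
  | by case/eqP: neq; congruence].
Qed.

(** Reversing an edge and negating its value leaves every imbalance unchanged;
    hence quantifying over orientations amounts to quantifying over signs. *)
Lemma admits_flow_signed (R : realType) (V E : finType) (G : multigraph V E)
    (D : digraph V E) (r alpha : R) :
  orientation_of G D ->
  admits_flow G r alpha <-> exists g, signed_flow D r alpha g.
Proof.
move=> oD; split=> [[D' [oD' [f [fb fa]]]]|[g [gb ga]]].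
  exists (fun e => if tail D' e == tail D e then f e else - f e); split=> [e|x].
    have /andP[f1 fr] := fb e.
    have f0 : 0 <= f e by apply: le_trans f1; exact: ler01.
    by case: ifP => _; rewrite ?normrN (ger0_norm f0) f1 fr.
  rewrite (_ : net D _ x = net D' f x); first exact: fa.
  rewrite !netE; apply: eq_bigr => e _.
  case: (orientation_of_cases e oD oD') => [[-> ->]|[-> -> /negPf ->]].
    by rewrite eqxx.
  by rewrite !mulNrn opprK addrC.
exists (Digraph (fun e => if 0 <= g e then tail D e else Defs.head D e)
                (fun e => if 0 <= g e then Defs.head D e else tail D e)).
split=> [e|] /=; first by rewrite oD; case: ifP => // _; rewrite finset.setUC.
exists (fun e => `|g e|); split=> // x.
rewrite [X in `|X|](_ : _ = net D g x); first exact: ga.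
rewrite -[LHS]/(net (Digraph _ _) _ x) !netE; apply: eq_bigr => e _ /=.
case: ifP => [g0|/negbT]; first by rewrite ger0_norm.
by rewrite -ltNge => /ltr0_norm ->; rewrite !mulNrn opprK addrC.
Qed.

Lemma degreeE (V E : finType) (G : multigraph V E) (D : digraph V E) (x : V) :
  orientation_of G D ->
  degree G x = (\sum_e ((tail D e == x) + (Defs.head D e == x)))%N.
Proof.
move=> oD; rewrite /degree -sum1_card big_mkcond; apply: eq_bigr => e _ /=.
rewrite !inE oD !inE ![x == _]eq_sym.
have := card_ends G e; rewrite oD cards2.
by case: (tail D e =P x) => [->|_]; case: (Defs.head D e =P x) => [->|_];
  rewrite ?eqxx.
Qed.

(** * The graph *)

Inductive corner := CornerA | CornerB | CornerC.

Definition nat_of_corner (c : corner) : nat :=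
  match c with CornerA => 0 | CornerB => 1 | CornerC => 2 end.

Definition corner_of_nat (n : nat) : corner :=
  match n with 0 => CornerA | 1 => CornerB | _ => CornerC end%N.

Lemma nat_of_cornerK : cancel nat_of_corner corner_of_nat.
Proof. by case. Qed.

HB.instance Definition _ := Countable.copy corner (can_type nat_of_cornerK).

Lemma corner_enumP : Finite.axiom [:: CornerA; CornerB; CornerC].
Proof. by case. Qed.

HB.instance Definition _ := isFinite.Build corner corner_enumP.

Inductive link := Bridge | LinkAB | LinkAC | LinkBC | LinkBC'.

Definition nat_of_link (l : link) : nat :=
  match l with
  | Bridge => 0 | LinkAB => 1 | LinkAC => 2 | LinkBC => 3 | LinkBC' => 4
  end.

Definition link_of_nat (n : nat) : link :=
  match n with
  | 0 => Bridge | 1 => LinkAB | 2 => LinkAC | 3 => LinkBC | _ => LinkBC'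
  end%N.

Lemma nat_of_linkK : cancel nat_of_link link_of_nat.
Proof. by case. Qed.

HB.instance Definition _ := Countable.copy link (can_type nat_of_linkK).

Lemma link_enumP :
  Finite.axiom [:: Bridge; LinkAB; LinkAC; LinkBC; LinkBC'].
Proof. by case. Qed.

HB.instance Definition _ := isFinite.Build link link_enumP.

(** [None] is the centre. *)
Definition vertex : finType := option ('I_3 * corner)%type.
Definition edge : finType := ('I_3 * link)%type.

Definition ref_tail (e : edge) : vertex :=
  match e.2 with
  | Bridge => None
  | LinkAB | LinkAC => Some (e.1, CornerA)
  | LinkBC | LinkBC' => Some (e.1, CornerB)
  end.

Definition ref_head (e : edge) : vertex :=
  Some (e.1, match e.2 with
             | Bridge => CornerA
             | LinkAB => CornerB
             | LinkAC | LinkBC | LinkBC' => CornerC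
             end).

Definition ref_orientation : digraph vertex edge := Digraph ref_tail ref_head.

Lemma card_ref_ends (e : edge) : #|[set ref_tail e; ref_head e]%SET| = 2%N.
Proof.
rewrite cards2 (_ : ref_tail e != ref_head e) //.
by case: e => i []; apply/eqP.
Qed.

Definition three_gadgets : multigraph vertex edge :=
  Multigraph card_ref_ends.

Lemma ref_orientationP : orientation_of three_gadgets ref_orientation.
Proof. by []. Qed.

Lemma big_edge (T : nmodType) (F : edge -> T) :
  \sum_e F e = \sum_(i < 3) (F (i, Bridge) + (F (i, LinkAB) +
    (F (i, LinkAC) + (F (i, LinkBC) + F (i, LinkBC'))))).
Proof.
rewrite (eq_bigr (fun e => F (e.1, e.2))); last by case.
rewrite -(pair_bigA _ (fun i l => F (i, l))) /=; apply: eq_bigr => i _.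
by rewrite -big_enum enumT Finite.enum.unlock /= !big_cons big_nil addr0.
Qed.

Lemma cubic_three_gadgets : cubic three_gadgets.
Proof.
move=> x; rewrite (degreeE x ref_orientationP).
rewrite (big_edge (fun e => (_ == x) + (_ == x))%N) !big_ord_recl big_ord0 /=.
by case: x => [[[[|[|[|i]]] // lti] []]|].
Qed.

Lemma net_centre (R : realType) (g : edge -> R) :
  net ref_orientation g None = \sum_i g (i, Bridge).
Proof.
rewrite netE big_edge; apply: eq_bigr => i _ /=.
rewrite /ref_tail /ref_head /= !mulr0n mulr1n; lra.
Qed.

(** The edges at a corner all belong to its own gadget. *)
Lemma net_corner (R : realType) (g : edge -> R) (i : 'I_3) (c : corner) :
  net ref_orientation g (Some (i, c)) =
    match c with
    | CornerA => g (i, LinkAB) + g (i, LinkAC) - g (i, Bridge)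
    | CornerB => g (i, LinkBC) + g (i, LinkBC') - g (i, LinkAB)
    | CornerC => - (g (i, LinkAC) + g (i, LinkBC) + g (i, LinkBC'))
    end.
Proof.
rewrite netE big_edge (bigD1 i) //= [X in _ + X]big1 => [|j ji].
  rewrite addr0 /ref_tail /ref_head /=.
  have e1 (a b : corner) : (Some (i, a) == Some (i, b) :> vertex) = (a == b).
    by rewrite -[LHS]/((i, a) == (i, b)) xpair_eqE eqxx.
  by rewrite !e1; case: c => /=; rewrite ?mulr0n ?mulr1n; lra.
have e0 (a b : corner) : (Some (j, a) == Some (i, b) :> vertex) = false.
  by rewrite -[LHS]/((j, a) == (i, b)) xpair_eqE (negPf ji).
by rewrite /ref_tail /ref_head /= !e0 !mulr0n !subr0 !addr0.
Qed.

(** * The lower bound *)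

Lemma norm_ge1_cases (R : realType) (x : R) : 1 <= `|x| -> 1 <= x \/ x <= -1.
Proof. by rewrite lerNr; case: (ger0P x) => _; [left|right]. Qed.

Lemma heavy_bridge (R : realType) (alpha : R) (u : 'I_3 -> R) :
  alpha < 1 -> (forall i, 1 <= `|u i|) -> `|\sum_i u i| <= alpha ->
  exists i, 2 - alpha <= `|u i|.
Proof.
move=> a1 u1.
pose i0 : 'I_3 := ord0; pose i1 := lift ord0 ord0 : 'I_3.
pose i2 := lift ord0 (lift ord0 ord0) : 'I_3.
have -> : \sum_i u i = u i0 + u i1 + u i2.
  by rewrite !big_ord_recl big_ord0 addr0 addrA.
rewrite ler_norml => /andP[].
have := norm_ge1_cases (u1 i0); have := norm_ge1_cases (u1 i1).
have := norm_ge1_cases (u1 i2).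
have n (i : 'I_3) : u i <= `|u i| /\ - u i <= `|u i|.
  by rewrite ler_norm -normrN ler_norm.
case: (n i0) (n i1) (n i2) => [? ?] [? ?] [? ?].
(* The bridge to choose is the one whose sign differs from the other two. *)
by do 3 case=> ?; move=> ? ?; first
  [exists i0; lra | exists i1; lra | exists i2; lra].
Qed.

Section Gadget.

Variables (R : realType) (alpha : R) (s ab ac bc bc' : R).
Hypothesis at_a : `|ab + ac - s| <= alpha.
Hypothesis at_b : `|bc + bc' - ab| <= alpha.
Hypothesis at_c : `|- (ac + bc + bc')| <= alpha.

(** The inner edges cancel when the three imbalances are added. *)
Lemma gadget_absorbs : `|s| <= 3 * alpha.
Proof. by move: at_a at_b at_c; rewrite !ler_norml; lra. Qed.

(** Say that [s > 0]. As [alpha < 1], the vertex a is not a sink, and the pair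
    {b, c} cannot absorb the at least 2 units that ab and ac would bring if
    both entered it; so one of ab, ac enters the pair and the other returns to
    a. If the two edges bc have the same direction, they lead to the end of
    the returning edge, which carries at least [2 - alpha]; the entering edge
    then carries at least [(2 - alpha) + (2 - alpha) - alpha]. If they have
    opposite directions, the entering edge carries at least
    [(2 - alpha) + 1 - alpha], and its end must send this and the at
    least 1 unit that comes back, up to [alpha], along a single edge bc. *)
Lemma gadget_capacity (m : R) :
  alpha < 1 -> 2 - alpha <= `|s| ->
  1 <= `|ab| <= m -> 1 <= `|ac| <= m -> 1 <= `|bc| <= m -> 1 <= `|bc'| <= m ->
  4 - 3 * alpha <= m.
Proof.
move=> a1 hs /andP[l1 u1] /andP[l2 u2] /andP[l3 u3] /andP[l4 u4].
move: at_a at_b at_c u1 u2 u3 u4; rewrite !ler_norml.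
have s1 : 1 <= `|s| by apply: le_trans hs; lra.
move: hs; case: (ger0P s) => ? ?;
case: (norm_ge1_cases l1) => ?; case: (norm_ge1_cases l2) => ?;
case: (norm_ge1_cases l3) => ?; case: (norm_ge1_cases l4) => ?; lra.
Qed.

End Gadget.

Lemma signed_flow_lower_bound (R : realType) (r alpha : R) (g : edge -> R) :
  2 <= r -> signed_flow ref_orientation r alpha g ->
  1 / 2 <= alpha /\ 5 - 3 * alpha <= r.
Proof.
move=> r2 [gb ga]; have [a1|a1] := leP 1 alpha; first by lra.
have ge1 i : 1 <= `|g (i, Bridge)| by case/andP: (gb (i, Bridge)).
have hc := ga None; rewrite net_centre in hc.
have [i hi] := heavy_bridge a1 ge1 hc.
have ha := ga (Some (i, CornerA)); rewrite net_corner in ha.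
have hb := ga (Some (i, CornerB)); rewrite net_corner in hb.
have hc' := ga (Some (i, CornerC)); rewrite net_corner in hc'.
have := gadget_absorbs ha hb hc'.
have := gadget_capacity ha hb hc' a1 hi (gb _) (gb _) (gb _) (gb _).
by lra.
Qed.

(** * The upper bound *)

(** The segment from the constant flow ([s = 0]) to the flow for (7/2, 1/2)
    ([s = 1/2]). The gadget 0 is the one with the heavy
    bridge; its largest value [1 + 3 * s] and the bound [1 - s] on the
    imbalances trace the slanted side of the domain. *)
Definition segment_flow (R : realType) (s : R) (e : edge) : R :=
  match val e.1, e.2 with
  | 0%N, Bridge => 1 + s
  | 0%N, LinkAB => 1 + 3 * s
  | 0%N, LinkAC => - (1 + s)
  | 0%N, _ => 1
  | _, Bridge => -1
  | _, LinkAB => - (1 + 2 * s)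
  | _, LinkAC => 1 + s
  | _, _ => -1
  end.

Lemma segment_flowP (R : realType) (r alpha s : R) :
  0 <= s -> s <= 1 / 2 -> 1 - s <= alpha -> 2 + 3 * s <= r ->
  signed_flow ref_orientation r alpha (segment_flow s).
Proof.
move=> s0 s1 sa sr; split=> [[[[|k] lti] l]|[[[[|k] lti] c]|]].
- rewrite /segment_flow /=; case: l => /=; rewrite ?normrN ger0_norm; lra.
- rewrite /segment_flow /=; case: l => /=; rewrite ?normrN ger0_norm; lra.
- by rewrite net_corner /segment_flow /=; case: c; rewrite ler_norml; lra.
- by rewrite net_corner /segment_flow /=; case: c; rewrite ler_norml; lra.
- rewrite net_centre !big_ord_recl big_ord0 /segment_flow /= ler_norml; lra.
Qed.

Theorem theorem42 (R : realType) :
  exists (V E : finType) (G : multigraph V E),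
    cubic G /\ bed R G = urd (7 / 2) (1 / 2).
Proof.
exists vertex, edge, three_gadgets; split; first exact: cubic_three_gadgets.
rewrite urd_7half_half; apply/seteqP; split=> -[r a]; rewrite /bed /=.
  move=> [r2 [_ /(admits_flow_signed _ _ ref_orientationP) [g gP]]].
  by have [? ?] := signed_flow_lower_bound r2 gP; split=> //; lra.
move=> [r2 a2 ra]; split=> //; split; first by lra.
apply/(admits_flow_signed _ _ ref_orientationP).
have [a1|a1] := leP 1 a.
  by exists (segment_flow 0); apply: segment_flowP; lra.
by exists (segment_flow (1 - a)); apply: segment_flowP; lra.
Qed.
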